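(* For all $n\ge1$ and all $\sigma\in S_n(321)$, $\mathrm{crs}(\Theta(\sigma))=\mathrm{crs}(\sigma)$.
   Context: $S_n(\tau)$: permutations of $[n]$ avoiding the pattern $\tau$. A crossing of $\sigma$ is a pair $(i,j)$ with $i<j<\sigma(i)<\sigma(j)$ or $\sigma(i)<\sigma(j)\le i<j$; $\mathrm{crs}(\sigma)$ is their number. Definition of $\Theta$ (Elizalde–Pak bijection $S_n(321)\to S_n(132)$): for $\sigma\in S_n(321)$ let $(P,Q)$ be the insertion and recording tableaux of the Robinson–Schensted (RSK) correspondence applied to $\sigma$ (at most two rows). $\Psi(\sigma)$ is the path of $2n$ steps $u=(1,1)$, $d=(1,-1)$ whose first $n$ steps are, for $i=1,\dots,n$, $u$ if $i$ is in the first row of $P$ and $d$ if in the second, and whose last $n$ steps are, for $j=n,\dots,1$, $u$ if $j$ is in the second row of $Q$ and $d$ if in the first; it is a Dyck path. In a Dyck path each up-step is matched with the first later down-step ending at the height where the up-step starts. Labelling up-steps left to right $n,\dots,1$ and down-steps left to right $1,\dots,n$, $\Phi^{-1}(D)$ is the permutation sending each up-step label to the label of its matched down-step; it is a bijection from Dyck paths of semilength $n$ onto $S_n(132)$. $\Theta=\Phi^{-1}\circ\Psi$. *)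

(* Defs.v *)
From mathcomp Require Import all_boot all_order all_algebra all_fingroup.

Set Implicit Arguments.
Unset Strict Implicit.
Unset Printing Implicit Defensive.

(* The set [n] is represented by 'I_n = {0, ..., n-1}: every value, position,  *)
(* tableau entry and step label is one less than in the usual convention.      *)

(* S_n(tau): the permutations with no subsequence order-isomorphic to tau. *)
Definition occurrence k n (tau : 'S_k) (sigma : 'S_n)
    (f : {ffun 'I_k -> 'I_n}) : bool :=
  [forall a : 'I_k, forall b : 'I_k, (a < b) ==> (f a < f b)] &&
  [forall a : 'I_k, forall b : 'I_k, (tau a < tau b) == (sigma (f a) < sigma (f b))].

Definition avoiding k n (tau : 'S_k) : {set 'S_n} :=
  [set sigma | ~~ [exists f, occurrence tau sigma f]].

Definition patt321 : 'S_3 := perm (@rev_ord_inj 3).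

Definition crossing n (sigma : 'S_n) (i j : 'I_n) : bool :=
  [&& i < j, j < sigma i & sigma i < sigma j] ||
  [&& sigma i < sigma j, sigma j <= i & i < j].

Definition crs n (sigma : 'S_n) : nat :=
  #|[set ij : 'I_n * 'I_n | crossing sigma ij.1 ij.2]|.

(* Robinson-Schensted row insertion; a tableau is the sequence of its rows,   *)
(* top row first, with pairwise distinct entries.                             *)
Fixpoint rs_insert (P : seq (seq nat)) (x : nat) : seq (seq nat) :=
  if P is row :: P' then
    let k := find (fun y => x < y) row in
    if k < size row then set_nth 0 row k x :: rs_insert P' (nth 0 row k)
    else rcons row x :: P'
  else [:: [:: x]].

(* Index of the row in which the insertion of x into P creates a new cell. *)
Fixpoint rs_new_row (P : seq (seq nat)) (x : nat) : nat :=
  if P is row :: P' then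
    let k := find (fun y => x < y) row in
    if k < size row then (rs_new_row P' (nth 0 row k)).+1 else 0
  else 0.

(* set_nth extends Q with a new row when r = size Q. *)
Definition add_cell (Q : seq (seq nat)) (r t : nat) : seq (seq nat) :=
  set_nth [::] Q r (rcons (nth [::] Q r) t).

Definition rs_step (PQ : seq (seq nat) * seq (seq nat)) (tx : nat * nat) :=
  (rs_insert PQ.1 tx.2, add_cell PQ.2 (rs_new_row PQ.1 tx.2) tx.1).

Definition rs (w : seq nat) : seq (seq nat) * seq (seq nat) :=
  foldl rs_step ([::], [::]) (zip (iota 0 (size w)) w).

Definition one_line n (sigma : 'S_n) : seq nat :=
  [seq val (sigma i) | i <- enum 'I_n].

(* Paths are boolean sequences: true is an up-step, false a down-step. *)
Definition path_of_tableaux n (P Q : seq (seq nat)) : seq bool :=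
  [seq i \in nth [::] P 0 | i <- iota 0 n] ++
  [seq j \in nth [::] Q 1 | j <- rev (iota 0 n)].

Definition Psi n (sigma : 'S_n) : seq bool :=
  let PQ := rs (one_line sigma) in path_of_tableaux n PQ.1 PQ.2.

(* Height of the path after its first k steps. *)
Definition height (D : seq bool) (k : nat) : int :=
  ((count_mem true (take k D))%:Z - (count_mem false (take k D))%:Z)%R.

Definition ups (D : seq bool) : seq nat :=
  [seq p <- iota 0 (size D) | nth false D p].

Definition downs (D : seq bool) : seq nat :=
  [seq q <- iota 0 (size D) | ~~ nth false D q].

(* Position of the first down-step after position p that ends at the height   *)
(* where step p starts (size D if there is none).                             *)
Definition matching_down (D : seq bool) (p : nat) : nat :=
  head (size D) [seq q <- downs D | (p < q) && (height D q.+1 == height D p)].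

(* The up-step labelled k is the (n-1-k)-th one from the left and the         *)
(* down-step labelled l is the l-th one (both counted from 0).                *)
Definition matched_label n (D : seq bool) (k : nat) : nat :=
  index (matching_down D (nth 0 (ups D) (n.-1 - k))) (downs D).

(* The permutation k |-> matched_label n D k. It exists (and is unique) when  *)
(* D is a Dyck path of semilength n; the value 1 is a default for the         *)
(* sequences that are not Dyck paths.                                         *)
Definition Phi_inv n (D : seq bool) : 'S_n :=
  odflt 1%g [pick p : 'S_n | [forall k, val (p k) == matched_label n D k]].

(* Meaningful on avoiding n patt321, where the tableaux have at most two rows. *)
Definition Theta n (sigma : 'S_n) : 'S_n := Phi_inv n (Psi sigma).

(* Main.v *)
Require Import Defs.
From mathcomp Require Import all_boot all_order all_algebra all_fingroup zify.

(* Induction on n, deleting the last letter x of sigma and standardizing: this *)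
(* gives sigma' with sigma = lift_perm ord_max x sigma'.                       *)
(* Row insertion of x changes the path in a very simple way: Psi sigma is      *)
(* Psi sigma' with a peak ud inserted at position x. Hence Theta sigma is      *)
(* Theta sigma' with a point inserted at (U, V), where U is the number of      *)
(* up-steps of Psi sigma' after position x and V the number of down-steps      *)
(* before it; one has U - V = n - x.                                           *)
(* For any permutation p, inserting a point at (U, V) with V <= U changes the  *)
(* number of crossings by a sum over the t in [V, U) of terms that depend only *)
(* on the relative positions of p^-1 t, t, p t, V and U. Avoidance of 321 by   *)
(* sigma makes the term 1 unless sigma' fixes t, and then all larger points.   *)
(* It also forces Psi sigma' to read d^k u^m between position x and its        *)
(* center; from this shape the term for Theta sigma' is again 1, except for    *)
(* the tunnels of the largest pyramid u^c d^c (c <= m) around the center. Such *)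
(* pyramids correspond to the final fixed points of sigma', so the two changes *)
(* agree.                                                                      *)

Set Implicit Arguments.
Unset Strict Implicit.
Unset Printing Implicit Defensive.

(** * Crossings and insertion of a point *)

(** The outline above rests on these lemmas. By [Psi_insert] and [matches_ins_peak], one more letter
    means one more peak in the path and one more point in its label permutation.
    [crs_lift_perm_marked] evaluates both changes in [crs]: each is [n - x] minus a number of marked
    labels, namely final fixed points in [crs_insert_last] and central pyramids in
    [crs_insert_label]; [pyramid_insert] keeps these two counts equal. The matching of the path is
    never computed: the induction [crs_matches] builds some [p] satisfying [matches], and
    [matches_Phi_inv] identifies it with the image under [Theta]. *)

Lemma crsE n (s : 'S_n) : crs s = \sum_i \sum_j crossing s i j.
Proof.
rewrite /crs -sum1_card pair_bigA big_mkcond /=.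
by apply: eq_bigr => -[i j] _ /=; rewrite inE /=; case: crossing.
Qed.

Lemma sum_nat_in_window n (V U : nat) (F : nat -> nat) : U <= n ->
  \sum_(t < n) (V <= t < U) * F t = \sum_(V <= t < U) F t.
Proof.
move=> leUn; rewrite (big_nat_widenl V 0) // (big_nat_widen 0 U n) //.
rewrite big_mkord [RHS]big_mkcond /=; apply: eq_bigr => i _.
by case: (V <= i); case: (i < U); rewrite ?mul1n ?mul0n.
Qed.

(** Here [a], [b] are positions and [c], [d] their values. Only a comparison of a position with a
    value can change, and only at a tie in [[v, u)], where the value moves up and the position
    stays. A tie [c == b] becomes an upper crossing; a tie [d == a] stops being a lower one. *)
Lemma crossing_bump (u v a b c d : nat) : v <= u ->
  ([&& bump u a < bump u b, bump u b < bump v c & bump v c < bump v d] ||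
   [&& bump v c < bump v d, bump v d <= bump u a & bump u a < bump u b])
    + [&& a < b, c < d, d == a & v <= a < u]
  = ([&& a < b, b < c & c < d] || [&& c < d, d <= a & a < b])
    + [&& a < b, c < d, c == b & v <= b < u].
Proof.
rewrite /bump => le_vu.
case: (ltnP a b) => ab; last by rewrite /= !andbF; lia.
case: (ltnP c d) => cd; last by rewrite /= !andbF; lia.
have -> : (u <= a) + a < (u <= b) + b by lia.
have -> : (v <= c) + c < (v <= d) + d by lia.
rewrite /= !andbT.
by case: (leqP u a); case: (leqP u b); case: (leqP v c); case: (leqP v d); lia.
Qed.

(** As [V <= U], the new point lies in no upper crossing; its lower crossings give the first two
    terms on the right. The terms in which [t] lies between its image and its preimage are the ties
    of [crossing_bump], lost on the left and gained on the right. *)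
Lemma crs_lift_perm n (U V : 'I_n.+1) (p : 'S_n) : V <= U ->
  crs (lift_perm U V p)
    + \sum_(t < n) (V <= t < U) * ((p t < t) && (t < (p^-1)%g t))
  = crs p + \sum_(t < n) (V <= t < U) *
      ((U <= (p^-1)%g t) + (p t < V) + (((p^-1)%g t < t) && (t < p t))).
Proof.
move=> leVU.
rewrite !crsE (bigD1_ord U) //= (bigD1_ord U) //=.
under [X in _ + X + _]eq_bigr => i _ do rewrite (bigD1_ord U) //=.
rewrite big_split /=.
have E1 : \sum_(j < n) crossing (lift_perm U V p) U (lift U j)
        = \sum_(t < n) (V <= t < U) * (U <= (p^-1)%g t).
  (* In [E1] the label [t] is the value of the other point; in [E2] it is its position. *)
  rewrite [RHS](reindex_inj (@perm_inj _ p)) /=; apply: eq_bigr => j _.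
  rewrite permK /crossing lift_perm_id lift_perm_lift /= /bump.
  by have := (ltn_ord j, ltn_ord (p j)); lia.
have E2 : \sum_(i < n) crossing (lift_perm U V p) (lift U i) U
        = \sum_(t < n) (V <= t < U) * (p t < V).
  apply: eq_bigr => i _.
  by rewrite /crossing lift_perm_id lift_perm_lift /= /bump; lia.
have E0 : crossing (lift_perm U V p) U U = false.
  by rewrite /crossing ltnn /= !andbF.
pose A (i j : 'I_n) := [&& i < j, p i < p j, p j == i & V <= i < U].
pose B (i j : 'I_n) := [&& i < j, p i < p j, p i == j & V <= j < U].
have E3 : \sum_(i < n) \sum_(j < n) crossing (lift_perm U V p) (lift U i) (lift U j)
          + \sum_(i < n) \sum_(j < n) A i j
        = \sum_(i < n) \sum_(j < n) crossing p i j
          + \sum_(i < n) \sum_(j < n) B i j.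
  rewrite -!big_split; apply: eq_bigr => i _.
  rewrite -!big_split; apply: eq_bigr => j _ /=.
  by rewrite /crossing /A /B !lift_perm_lift -!val_eqE; apply: crossing_bump.
have EA : \sum_(i < n) \sum_(j < n) A i j
        = \sum_(t < n) (V <= t < U) * ((p t < t) && (t < (p^-1)%g t)).
  apply: eq_bigr => i _; rewrite (bigD1 ((p^-1)%g i)) //= big1 => [|j nj].
    by rewrite /A permKV eqxx; lia.
  rewrite /A; suff /negPf-> : p j != i by rewrite !andbF.
  by apply: contraNneq nj => <-; rewrite permK.
have EB : \sum_(i < n) \sum_(j < n) B i j
        = \sum_(t < n) (V <= t < U) * (((p^-1)%g t < t) && (t < p t)).
  rewrite exchange_big; apply: eq_bigr => j _.
  rewrite (bigD1 ((p^-1)%g j)) //= big1 => [|i ni].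
    by rewrite /B permKV eqxx; lia.
  rewrite /B; suff /negPf-> : p i != j by rewrite !andbF.
  by apply: contraNneq ni => <-; rewrite permK.
under [X in _ = _ + X]eq_bigr => t _ do rewrite !mulnDr.
rewrite !big_split /= -EA -EB -E1 -E2 E0 add0n.
by rewrite -!addnA E3 [X in _ + X = _]addnCA addnCA.
Qed.

Lemma crs_lift_perm_marked n (U V : 'I_n.+1) (p : 'S_n) (good : pred nat) :
    V <= U ->
    (forall t : 'I_n, V <= t < U -> (p t < t) && (t < (p^-1)%g t) = false) ->
    (forall t : 'I_n, V <= t < U ->
       (U <= (p^-1)%g t) + (p t < V) + (((p^-1)%g t < t) && (t < p t))
       + good t = 1) ->
  crs (lift_perm U V p) + \sum_(V <= t < U) good t = crs p + (U - V).
Proof.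
move=> leVU dd0 gd; have := crs_lift_perm p leVU.
rewrite big1 ?addn0 => [->|t _]; last by case: (boolP (_ <= _ < _)) => // /dd0->.
have leUn : U <= n by rewrite -ltnS.
rewrite -addnA -(sum_nat_in_window V _ leUn) -big_split /=; congr addn.
rewrite -[RHS]muln1 -sum_nat_const_nat -(sum_nat_in_window V _ leUn).
by apply: eq_bigr => t _; rewrite -mulnDr; case: (boolP (_ <= _ < _)) => // /gd->.
Qed.

(** * Tunnels and insertion of a peak *)

Definition nups (D : seq bool) k := count_mem true (take k D).
Definition ndowns (D : seq bool) k := count_mem false (take k D).

Lemma nupsS D k : nups D k.+1 = nups D k + nth false D k.
Proof.
rewrite /nups; have [ltk|gek] := ltnP k (size D).
  by rewrite (take_nth false) // -cats1 count_cat /= eqb_id addn0.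
by rewrite nth_default // addn0 !take_oversize // leqW.
Qed.

Lemma ndownsS D k : ndowns D k.+1 = ndowns D k + ~~ nth true D k.
Proof.
rewrite /ndowns; have [ltk|gek] := ltnP k (size D).
  by rewrite (take_nth true) // -cats1 count_cat /= eqbF_neg addn0.
by rewrite nth_default // addn0 !take_oversize // leqW.
Qed.

Lemma nups_add_ndowns D k : k <= size D -> nups D k + ndowns D k = k.
Proof.
move=> lek; rewrite /nups /ndowns -[RHS](size_takel lek) -(count_predC (pred1 true)).
by congr addn; apply: eq_count; case.
Qed.

Lemma nups_mono D : {homo nups D : i j / i <= j}.
Proof.
move=> i j /subnK <-; elim: (j - i) => // k; rewrite addSn nupsS; lia.
Qed.

Lemma ndowns_mono D : {homo ndowns D : i j / i <= j}.
Proof.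
move=> i j /subnK <-; elim: (j - i) => // k; rewrite addSn ndownsS; lia.
Qed.

Definition ins_peak x (D : seq bool) := take x D ++ [:: true; false] ++ drop x D.

Lemma size_ins_peak x D : size (ins_peak x D) = (size D).+2.
Proof. by rewrite -[in RHS](cat_take_drop x D) /ins_peak !size_cat /=; lia. Qed.

Lemma nth_ins_peak b x D i : x <= size D ->
  nth b (ins_peak x D) i =
    if i < x then nth b D i else
    if i == x then true else if i == x.+1 then false else nth b D (i - 2).
Proof.
move=> lex; rewrite /ins_peak nth_cat size_takel //.
have [ltix|leix] := ltnP i x; first by rewrite nth_take.
have [->|nix] := eqVneq i x; first by rewrite subnn.
have [->|nix1] := eqVneq i x.+1; first by rewrite subSnn.
have -> : i - x = (i - x - 2).+2 by lia.
by rewrite /= nth_drop; congr nth; lia.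
Qed.

Lemma nups_ins_peak x D k : x <= size D ->
  nups (ins_peak x D) k = if k <= x then nups D k else (nups D (maxn x (k - 2))).+1.
Proof.
move=> lex; elim: k => [|k IH]; first by rewrite /nups !take0.
rewrite nupsS IH nth_ins_peak //.
have [ltkx|lexk] := ltnP k x; first by rewrite (ltnW ltkx) nupsS.
have [->|nkx] := eqVneq k x.
  by rewrite leqnn addn1 (maxn_idPl _) //; lia.
have [->|nkx1] := eqVneq k x.+1.
  by rewrite ltnn addn0 !(maxn_idPl _) //; lia.
have -> : k <= x = false by lia.
have -> : maxn x (k - 2) = k - 2 by lia.
by rewrite addSn -nupsS; do 2!f_equal; lia.
Qed.

Lemma ndowns_ins_peak x D k : x <= size D ->
  ndowns (ins_peak x D) k = if k <= x.+1 then ndowns D (minn k x) else (ndowns D (k - 2)).+1.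
Proof.
move=> lex; elim: k => [|k IH]; first by rewrite min0n /ndowns !take0.
rewrite ndownsS IH nth_ins_peak //.
have [ltkx|lexk] := ltnP k x.
  by rewrite !(leq_trans _ (leqnSn x)) ?(ltnW ltkx) // !(minn_idPl _) ?ndownsS // ltnW.
have [->|nkx] := eqVneq k x.
  by rewrite leqnSn ltnSn addn0; congr ndowns; lia.
have [->|nkx1] := eqVneq k x.+1.
  by rewrite leqnn ltnn addn1 !subSS subn0.
have -> : k <= x.+1 = false by lia.
have -> : k.+1 <= x.+1 = false by lia.
by rewrite addSn -ndownsS; do 2!f_equal; lia.
Qed.

(** Heights are [nups - ndowns], with the negative terms moved across to stay in [nat]. Strictness
    up to [q] makes [q] the first return to the starting height. *)
Definition tunnel (D : seq bool) p q :=
  [/\ p < q < size D, nth false D p, ~~ nth true D q,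
      nups D q.+1 + ndowns D p = nups D p + ndowns D q.+1
    & forall r, p < r <= q -> nups D p + ndowns D r < nups D r + ndowns D p].

Lemma tunnel_peak x D : x <= size D -> tunnel (ins_peak x D) x x.+1.
Proof.
move=> lex; have Nx b : nth b (ins_peak x D) x = true.
  by rewrite nth_ins_peak // ltnn eqxx.
have NSx b : nth b (ins_peak x D) x.+1 = false.
  by rewrite nth_ins_peak // eqxx ltnNge leqnSn eqn_leq ltnn.
split; rewrite ?Nx ?NSx ?size_ins_peak //; first by lia.
  by rewrite !nupsS !ndownsS !Nx !NSx; lia.
move=> r hr; have -> : r = x.+1 by lia.
by rewrite nupsS ndownsS !Nx; lia.
Qed.

(** Position in [ins_peak x D] of step [i] of [D]. *)
Definition shift2 x i := if i < x then i else i.+2.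

Lemma nups_shift2 x D i : x <= size D ->
  nups (ins_peak x D) (shift2 x i) = nups D i + (x <= i).
Proof.
move=> lex; rewrite nups_ins_peak // /shift2; have [ltix|leix] := ltnP i x.
  by rewrite (ltnW ltix) addn0.
have -> : i.+2 <= x = false by lia.
have -> : maxn x (i.+2 - 2) = i by lia.
by rewrite addn1.
Qed.

Lemma ndowns_shift2 x D i : x <= size D ->
  ndowns (ins_peak x D) (shift2 x i) = ndowns D i + (x <= i).
Proof.
move=> lex; rewrite ndowns_ins_peak // /shift2; have [ltix|leix] := ltnP i x.
  by rewrite (leq_trans (ltnW ltix)) // (minn_idPl (ltnW ltix)) addn0.
by rewrite !ltnS (leqNgt _ x) ltnS leix /= subSS subSS subn0 addn1.
Qed.

Lemma nth_shift2 b x D i : x <= size D ->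
  nth b (ins_peak x D) (shift2 x i) = nth b D i.
Proof.
move=> lex; rewrite nth_ins_peak // /shift2; have [->//|leix] := ltnP i x.
have -> : i.+2 < x = false by lia.
have -> : (i.+2 == x) = false by lia.
have -> : (i.+2 == x.+1) = false by lia.
by rewrite !subSS subn0.
Qed.

(** If the tunnel straddles [x], its condition at [r = x] also covers the two vertices added by the
    peak, which lie at the height of [x] or one above. *)
Lemma tunnel_ins_peak x D p q : x <= size D ->
  tunnel D p q -> tunnel (ins_peak x D) (shift2 x p) (shift2 x q).
Proof.
move=> lex [hpq Dp Dq hq hr].
split; rewrite ?nth_shift2 //.
- by rewrite size_ins_peak /shift2; do 2!case: ifP; lia.
- rewrite !nupsS !ndownsS !nth_shift2 // !nups_shift2 // !ndowns_shift2 //.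
  by move: hq; rewrite nupsS ndownsS; lia.
move=> r hpr; rewrite nups_shift2 // ndowns_shift2 //.
have [ltrx|[rx|[rx|ltxr]]] : r < x \/ r = x \/ r = x.+1 \/ x.+2 <= r by lia.
- have hs : p < r <= q by move: hpr; rewrite /shift2; do 2!case: ifP; lia.
  rewrite nups_ins_peak // ndowns_ins_peak // (ltnW ltrx) (leq_trans (ltnW ltrx)) //.
  have -> : minn r x = r by lia.
  by have := hr _ hs; lia.
- have hs : p < x <= q by move: hpr; rewrite /shift2; do 2!case: ifP; lia.
  rewrite rx nups_ins_peak // ndowns_ins_peak // leqnn leqnSn minnn.
  by have := hr _ hs; lia.
- have hs : p < x <= q by move: hpr; rewrite /shift2; do 2!case: ifP; lia.
  rewrite rx nups_ins_peak // ndowns_ins_peak // leqnn ltnn.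
  have -> : minn x.+1 x = x by lia.
  have -> : maxn x (x.+1 - 2) = x by lia.
  by have := hr _ hs; lia.
have hs : p < r - 2 <= q by move: hpr; rewrite /shift2; do 2!case: ifP; lia.
rewrite nups_ins_peak // ndowns_ins_peak //.
have -> : r <= x = false by lia.
have -> : r <= x.+1 = false by lia.
have -> : maxn x (r - 2) = r - 2 by lia.
by have := hr _ hs; lia.
Qed.

(* [p] is the label permutation of [D]: the label of an up-step is the number *)
(* of later up-steps, that of a down-step the number of earlier down-steps.   *)
Definition matches n (D : seq bool) (p : 'S_n) := forall k : 'I_n,
  exists a b, [/\ tunnel D a b, nups D a.+1 + k = n & ndowns D b = p k].

(** Up-steps before [x] gain a later up-step and down-steps after [x] gain an earlier down-step:
    these are the labels that [bump] raises. *)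
Lemma matches_ins_peak n x D (p : 'S_n) (U V : 'I_n.+1) :
    x <= size D -> nups D x + U = n -> ndowns D x = V -> matches D p ->
  matches (ins_peak x D) (lift_perm U V p).
Proof.
move=> lex hU hV mp k; have [k' ->|->] := unliftP U k.
  have [a [b [tab ha hb]]] := mp k'.
  exists (shift2 x a), (shift2 x b); split; first exact: tunnel_ins_peak.
    have [_ Da _ _ _] := tab.
    rewrite nupsS nups_shift2 // nth_shift2 //= /bump.
    move: ha; rewrite nupsS Da; have [ltax|lexa] := ltnP a x.
      by have := @nups_mono D _ _ ltax; rewrite nupsS Da; lia.
    by have := @nups_mono D _ _ lexa; lia.
  have [_ _ Db _ _] := tab.
  rewrite lift_perm_lift ndowns_shift2 //= /bump -hb -hV.
  have [ltbx|lexb] := ltnP b x.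
    by have := @ndowns_mono D _ _ ltbx; rewrite ndownsS Db; lia.
  by have := @ndowns_mono D _ _ lexb; lia.
exists x, x.+1; split; first exact: tunnel_peak.
  rewrite nupsS nth_ins_peak // ltnn eqxx nups_ins_peak // leqnn; lia.
rewrite lift_perm_id ndowns_ins_peak // leqnn -hV; congr ndowns; lia.
Qed.

Lemma index_filter_iota (P : pred nat) m q : q < m -> P q ->
  index q [seq i <- iota 0 m | P i] = count P (iota 0 q).
Proof.
move=> ltqm Pq; have -> : m = q + (1 + (m - q.+1)) by lia.
rewrite !iotaD !filter_cat index_cat.
rewrite mem_filter mem_iota ?add0n ltnn andbF /= ?add0n Pq /= eqxx.
by rewrite addn0 size_filter.
Qed.

Lemma index_ups D a : nth false D a -> index a (ups D) = nups D a.
Proof.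
move=> Da; have lta : a < size D by rewrite ltnNge; apply: contraL Da => leDa; rewrite nth_default.
rewrite /ups index_filter_iota // /nups -(mkseq_nth false (take a D)).
rewrite (size_takel (ltnW lta)) count_map; apply: eq_in_count => i.
by rewrite mem_iota /= => ltia; rewrite nth_take //= eqb_id.
Qed.

Lemma index_downs D b : ~~ nth true D b -> index b (downs D) = ndowns D b.
Proof.
move=> Db; have ltb : b < size D by rewrite ltnNge; apply: contra Db => leDb; rewrite nth_default.
rewrite /downs index_filter_iota // ?(set_nth_default true) //.
rewrite /ndowns -(mkseq_nth false (take b D)).
rewrite (size_takel (ltnW ltb)) count_map; apply: eq_in_count => i.
by rewrite mem_iota /= => ltib; rewrite nth_take //= eqbF_neg.
Qed.

Lemma head_filter_sorted (P : pred nat) x0 q s :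
    sorted ltn s -> q \in s -> P q -> (forall r, r \in s -> P r -> q <= r) ->
  head x0 [seq r <- s | P r] = q.
Proof.
elim: s => // r s IH /= srt; rewrite inE => qs Pq minq.
case: ifP => Pr /=.
  have leqr : q <= r by apply: minq; rewrite ?mem_head.
  case/orP: qs => [/eqP->//|qs].
  by have := allP (order_path_min ltn_trans srt) q qs => /=; lia.
apply: IH => //; first exact: path_sorted srt.
  by case/orP: qs => [/eqP qr|//]; rewrite qr Pr in Pq.
by move=> r' r's; apply: minq; rewrite inE r's orbT.
Qed.

Lemma tunnel_matching_down D a b : tunnel D a b -> matching_down D a = b.
Proof.
case=> hab Da Db hb hr; have [_ ltb] := andP hab.
rewrite /matching_down; apply: head_filter_sorted.
- by apply: sorted_filter => //; [exact: ltn_trans | exact: iota_ltn_sorted].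
- by rewrite mem_filter mem_iota /= (set_nth_default true) // Db.
- rewrite /height -/(nups D b.+1) -/(ndowns D b.+1) -/(nups D a) -/(ndowns D a). lia.
move=> r _; rewrite /height -/(nups D r.+1) -/(ndowns D r.+1) -/(nups D a) -/(ndowns D a).
case/andP=> ltar hra; rewrite leqNgt; apply/negP => ltrb.
have : a < r.+1 <= b by lia.
move=> /hr; lia.
Qed.

Lemma matches_matched_label n D (p : 'S_n) : nups D (size D) = n -> matches D p ->
  forall k : 'I_n, matched_label n D k = p k.
Proof.
move=> cuD mp k; have [a [b [tab ha <-]]] := mp k.
have [_ Da Db _ _] := tab.
rewrite /matched_label.
rewrite (_ : nth 0 _ _ = a); last first.
  have -> : n.-1 - k = index a (ups D).
    by rewrite index_ups //; move: ha; rewrite nupsS Da; lia.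
  apply: nth_index; rewrite mem_filter Da mem_iota /= add0n.
  by rewrite ltnNge; apply: contraL Da => leDa; rewrite nth_default.
by rewrite (tunnel_matching_down tab) index_downs.
Qed.

(** The labels determine the permutation, so [pick] can neither choose another one nor fall back to
    the default. *)
Lemma matches_Phi_inv n D (p : 'S_n) : nups D (size D) = n -> matches D p ->
  Phi_inv n D = p.
Proof.
move=> cuD mp; have lab := matches_matched_label cuD mp.
rewrite /Phi_inv; case: pickP => [p' /forallP hp'|/(_ p)/forallP[]] /=.
  by apply/permP => k; apply: val_inj; rewrite (eqP (hp' k)) lab.
by move=> k; rewrite lab.
Qed.

(** * The change in the number of crossings *)

Definition downs_first x n (D : seq bool) :=
  forall y z, x <= y -> y < z < n -> nth false D y -> nth false D z.

(* Around position [n], the path [D] reads [l] up-steps, then [l] down-steps. *)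
Definition pyramid n (D : seq bool) l :=
  (nups D n == nups D (n - l) + l) && (nups D (n + l) == nups D n).

Lemma downs_first_cu x n D y : downs_first x n D -> x <= y < n ->
  nth false D y -> nups D n = nups D y + (n - y).
Proof.
move=> Dx hy Dy.
suff H m : m <= n - y -> nups D (y + m) = nups D y + m.
  by rewrite -H // subnKC //; lia.
elim: m => [|m IH] hm; first by rewrite !addn0.
rewrite addnS nupsS IH; last by lia.
case: m hm {IH} => [|m] hm; first by rewrite !addn0 Dy; lia.
by rewrite (Dx y) //; lia.
Qed.

Section PathSide.

Variables (n x : nat) (D : seq bool) (p : 'S_n).
Hypotheses (szD : size D = n + n) (lexn : x <= n).
Hypotheses (Dx : downs_first x n D) (mp : matches D p).

Lemma matches_inv (t : 'I_n) :
  exists a b, [/\ tunnel D a b, nups D a.+1 + (p^-1)%g t = n & ndowns D b = t].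
Proof. by have := mp ((p^-1)%g t); rewrite permKV. Qed.

Let cucd k : k <= n + n -> nups D k + ndowns D k = k.
Proof. by rewrite -szD; apply: nups_add_ndowns. Qed.

(** The down-step labelled [t] lies between [x] and the center. An up-step between [x] and it would
    exclude a down-step there, so its partner precedes [x]. *)
Lemma matches_before_center (t : 'I_n) : ndowns D x <= t < ndowns D n ->
  n <= nups D x + (p^-1)%g t.
Proof.
have [a [b [tab ha hb]]] := matches_inv t => ht.
have [hab Da Db _ _] := tab.
have ltbn : b < n by rewrite ltnNge; apply/negP => /(@ndowns_mono D); lia.
have lexb : x <= b.
  rewrite leqNgt; apply/negP => /(@ndowns_mono D); rewrite ndownsS Db; lia.
have ltax : a < x.
  rewrite ltnNge; apply/negP => lexa; case/negP: Db.
  by rewrite (set_nth_default false); [apply: (Dx lexa) => //; lia | lia].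
by have := @nups_mono D _ _ ltax; lia.
Qed.

(** There are [ndowns D n] up-steps after the center, and they carry the smallest labels. So the
    up-step labelled [t] is past the center, and so is its partner. *)
Lemma matches_after_center (t : 'I_n) : t < ndowns D n -> ndowns D n <= p t.
Proof.
have [a [b [[hab _ _ _ _] ha <-]]] := mp t => ht.
have lena : n <= a.
  rewrite leqNgt; apply/negP => /(@nups_mono D); have := @cucd n (leq_addr _ _); lia.
by apply: ndowns_mono; lia.
Qed.

(** With [t = ndowns D n + s], and counting away from the center, [t] labels the up-step number
    [s + 1] on the left and the down-step number [s + 1] on the right. In a pyramid these two match.
    Otherwise extra up-steps on the right delay the partner of the first and make the partner of the
    second start later. *)
Lemma matches_across (t : 'I_n) : ndowns D n <= t -> nups D x + t < n ->
  if pyramid n D (t - ndowns D n).+1 then p t = t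
  else ((p^-1)%g t < t) && (t < p t).
Proof.
move=> let_ ltt; have ecu := @cucd n (leq_addr _ _).
set s := t - ndowns D n; have st : t = ndowns D n + s :> nat by rewrite /s; lia.
have [a0 [b0 [[hab0 Da0 Db0 eq0 min0] ha0 hb0]]] := mp t.
have [a1 [b1 [[hab1 Da1 Db1 eq1 min1] ha1 hb1]]] := matches_inv t.
have lta0n : a0 < n by rewrite ltnNge; apply/negP => /(@nups_mono D); rewrite nupsS Da0 in ha0; lia.
have lexa0 : x <= a0 by rewrite leqNgt; apply/negP => /(@nups_mono D); lia.
have cua0 : nups D n = nups D a0 + (n - a0).
  by apply: (downs_first_cu Dx); rewrite ?lexa0.
have cda0 : nups D a0 + ndowns D a0 = a0 by apply: cucd; lia.
have a0E : a0 = n - s.+1 by rewrite nupsS Da0 in ha0; lia.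
have lesn : s.+1 <= n by rewrite nupsS Da0 in ha0; lia.
have lenb1 : n <= b1 by rewrite leqNgt; apply/negP => /(@ndowns_mono D); rewrite ndownsS Db1; lia.
have cdb1 : ndowns D b1.+1 = ndowns D n + s.+1 by rewrite ndownsS Db1 hb1; lia.
have cucdb1 : nups D b1.+1 + ndowns D b1.+1 = b1.+1 by apply: cucd; lia.
have lenb0 : n <= b0.
  rewrite leqNgt; apply/negP => ltb0n; case/negP: Db0.
  by rewrite (set_nth_default false); [apply: (Dx lexa0) => //; lia | lia].
have cucdb0 : nups D b0.+1 + ndowns D b0.+1 = b0.+1 by apply: cucd; lia.
have cucds : nups D (n + s.+1) + ndowns D (n + s.+1) = n + s.+1 by apply: cucd; lia.
have lecub0 := @nups_mono D n b0.+1 (leqW lenb0).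
have cdSb0 := ndownsS D b0; rewrite Db0 in cdSb0.
(* The left half of the pyramid always holds here; only the right half is in doubt. *)
rewrite /pyramid -a0E; case: eqP => [_|]; last by lia.
case: eqP => [peak|notpeak] /=.
  apply: val_inj => /=; rewrite -hb0.
  have leb0 : b0 < n + s.+1.
    rewrite ltnNge; apply/negP => leb0.
    by have := min0 (n + s.+1); lia.
  by have := @nups_mono D _ _ leb0; lia.
have cun : nups D n < nups D (n + s.+1).
  by rewrite ltn_neqAle nups_mono ?leq_addr // andbT; apply/eqP => h; apply: notpeak.
have ltb1 : n + s.+1 < b1.+1.
  by rewrite ltnNge; apply/negP => /(@ndowns_mono D); lia.
have lecub1 := @nups_mono D _ _ (ltnW ltb1).
(* Step [b1] ends above the height at [a0], so its tunnel cannot start at or before [a0]. *)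
have lta01 : a0 < a1.
  rewrite ltnNge; apply/negP; rewrite leq_eqVlt => /orP[/eqP a01|lta10].
    by move: eq1; rewrite a01; lia.
  by have := min1 a0; lia.
have lt1 : (p^-1)%g t < t.
  by have := @nups_mono D _ _ lta01; rewrite nupsS Da1 in ha1; lia.
rewrite lt1 /= ltn_neqAle; apply/andP; split.
  apply: contraTneq lt1 => /= tpt; rewrite -leqNgt.
  by rewrite (_ : (p^-1)%g t = t) //; apply: (@perm_inj _ p); rewrite permKV; apply: val_inj.
by rewrite -hb0; lia.
Qed.

Lemma crs_insert_label (U V : 'I_n.+1) : nups D x + U = n -> ndowns D x = V ->
  crs (lift_perm U V p) + \sum_(1 <= l < (n - x).+1) pyramid n D l
    = crs p + (n - x).
Proof.
move=> hU hV; have ecu := @cucd n (leq_addr _ _).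
have xcu : nups D x + ndowns D x = x by apply: cucd; lia.
have lecu := @nups_mono D _ _ lexn; have lecd := @ndowns_mono D _ _ lexn.
pose good t := (ndowns D n <= t) && pyramid n D (t - ndowns D n).+1.
have -> : \sum_(1 <= l < (n - x).+1) pyramid n D l = \sum_(V <= t < U) good t.
  (* A pyramid of size [l] needs [l] up-steps between [x] and the center, so larger sizes contribute
     nothing. *)
  rewrite (big_cat_nat (n := (nups D n - nups D x).+1)) //=; last by lia.
  rewrite [X in _ + X = _]big_nat_cond [X in _ + X = _]big1 ?addn0 => [|l /andP[hl _]]; last first.
    rewrite /pyramid; case: eqP => //= h.
    by have := @nups_mono D x (n - l); lia.
  rewrite [RHS](big_cat_nat (n := ndowns D n)) //=; [|lia..].
  rewrite [X in _ = X + _]big_nat_cond [X in _ = X + _]big1 ?add0n => [|t /andP[ht _]]; last first.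
    by rewrite /good leqNgt; case/andP: ht => _ ->.
  have -> : U = nups D n - nups D x + ndowns D n :> nat by lia.
  rewrite -[X in \sum_(X <= _ < _) good _]add0n big_addn addnK big_add1 /=; apply: eq_big_nat => t _.
  by rewrite /good leq_addl addnK.
have -> : n - x = U - V by lia.
apply: crs_lift_perm_marked => [|t ht|t ht]; first by lia.
  have [ltt|let_] := ltnP t (ndowns D n).
    by have := matches_after_center ltt; lia.
  have := matches_across let_; case: ifP => _ H; first by rewrite H ?ltnn //; lia.
  by have := H ltac:(lia); lia.
rewrite /good; have [ltt|let_] := ltnP t (ndowns D n).
  have := matches_after_center ltt; have := @matches_before_center t.
  by rewrite -hV; lia.
have := matches_across let_; case: ifP => _ H.
  have pt : p t = t by apply: H; lia.
  have -> : (p^-1)%g t = t by rewrite -{1}pt permK.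
  by rewrite pt ltnn; lia.
by have := H ltac:(lia); lia.
Qed.

End PathSide.

(** * Avoidance of 321 and the change for [s] *)

Definition no321 n (s : 'S_n) :=
  forall i j k : 'I_n, i < j < k -> s k < s j -> s j < s i -> False.

Lemma avoiding_no321 n (s : 'S_n) : s \in avoiding n patt321 -> no321 s.
Proof.
rewrite inE => /negP av i j k /andP[ij jk] kj ji; apply: av; apply/existsP.
exists [ffun a : 'I_3 => if val a == 0 then i else if val a == 1 then j else k].
have ki := ltn_trans kj ji; have ik := ltn_trans ij jk.
apply/andP; split; apply/forallP => a; apply/forallP => b; rewrite !ffunE.
  by case: a => -[|[|[|?]]] //= ?; case: b => -[|[|[|?]]] //= ?;
     rewrite ?ij ?jk ?ik.
have [jk' ij' ik'] : [/\ s j < s k = false, s i < s j = false & s i < s k = false].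
  by split; lia.
by rewrite !permE; case: a => -[|[|[|?]]] //= ?; case: b => -[|[|[|?]]] //= ?;
  rewrite ?ltnn ?kj ?ji ?ki ?jk' ?ij' ?ik'.
Qed.

Lemma perm_prefix_le n (s : 'S_n) m k : m <= n ->
  (forall r : 'I_n, r < m -> s r < k) -> m <= k.
Proof.
move=> lemn small.
have uS : uniq [seq val (s (widen_ord lemn r)) | r <- enum 'I_m].
  rewrite map_inj_uniq ?enum_uniq // => i j /val_inj/perm_inj/(congr1 val)/=.
  exact: val_inj.
have := uniq_leq_size uS (s2 := iota 0 k); rewrite size_map size_enum_ord size_iota.
by apply=> _ /mapP[r _ ->]; rewrite mem_iota /= small /=.
Qed.

Section LastPoint.

Variables (n : nat) (x : 'I_n.+1) (s : 'S_n).
Hypothesis av : no321 (lift_perm ord_max x s).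

Lemma no321_no_descent (i j : 'I_n) : i < j -> x <= s j -> s j < s i -> False.
Proof.
move=> ij xj ji; apply: (av (i := lift ord_max i) (j := lift ord_max j) (k := ord_max)).
- by rewrite !lift_max ij /=.
- by rewrite lift_perm_id lift_perm_lift /= /bump; lia.
- by rewrite !lift_perm_lift /= /bump; lia.
Qed.

Lemma no321_lift : no321 s.
Proof.
move=> i j k hijk kj ji.
apply: (av (i := lift ord_max i) (j := lift ord_max j) (k := lift ord_max k)).
- by rewrite !lift_max.
- by rewrite !lift_perm_lift /= /bump; lia.
- by rewrite !lift_perm_lift /= /bump; lia.
Qed.

(** If [t] stood at a position beyond [t], pigeonhole would put a larger value before it: a descent
    above [x], which the last letter completes to 321. *)
Lemma no321_perm_inv_le (t : 'I_n) : x <= t -> (s^-1)%g t <= t.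
Proof.
move=> xt; rewrite leqNgt; apply/negP => lt.
have /exists_inP[r rt tr] : [exists (r : 'I_n | r < (s^-1)%g t), t < s r].
  apply: contraLR lt; rewrite negb_exists_in -leqNgt => /forall_inP small.
  apply: (@perm_prefix_le _ s); first exact: ltnW.
  move=> r rt; have := small r rt; rewrite -leqNgt leq_eqVlt => /orP[/eqP/val_inj E|//].
  by move: rt; rewrite -E permK ltnn.
by apply: (no321_no_descent rt); rewrite permKV.
Qed.

(** The position of [t'] is at most [t']. It is not before [t], by the absence of descents above
    [x], and not in [[t, t')], whose points are fixed by induction. *)
Lemma no321_fixed_above (t t' : 'I_n) : x <= t -> s t = t -> t <= t' -> s t' = t'.
Proof.
move=> xt st; have [m] := ubnP (val t'); elim: m t' => // m IH t' ltm.
rewrite leq_eqVlt => /orP[/eqP/val_inj<-//|tt'].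
have xt' := leq_trans xt (ltnW tt').
have letu : t <= (s^-1)%g t'.
  rewrite leqNgt; apply/negP => ut.
  by apply: (no321_no_descent ut); rewrite st ?permKV.
have := no321_perm_inv_le xt'; rewrite leq_eqVlt => /orP[/eqP/val_inj E|ltu].
  by rewrite -{1}E permKV.
have /(congr1 val) := IH _ (leq_trans ltu ltm) letu.
by rewrite permKV /=; lia.
Qed.

Definition fixes_from (t : nat) := [forall t' : 'I_n, (t <= t') ==> (s t' == t')].

(** The new point is last, so it crosses the point at position [t] exactly when [s t < x]. Otherwise
    [no321_perm_inv_le], applied to [t] and to [s t], puts [t] between its preimage and its image,
    and a tie is gained unless [t] is fixed. *)
Lemma crs_insert_last :
  crs (lift_perm ord_max x s) + \sum_(1 <= l < (n - x).+1) fixes_from (n - l)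
  = crs s + (n - x).
Proof.
have lexn : x <= n by rewrite -ltnS.
have -> : \sum_(1 <= l < (n - x).+1) fixes_from (n - l)
        = \sum_(x <= t < n) fixes_from t.
  rewrite big_nat_rev big_add1 /= -[in RHS](add0n x) big_addn.
  by apply: eq_big_nat => l hl; congr (nat_of_bool (fixes_from _)); lia.
apply: (@crs_lift_perm_marked n ord_max x s fixes_from) => // t /andP[xt _] /=.
  by have := no321_perm_inv_le xt; lia.
have fixE : fixes_from t = (s t == t).
  apply/idP/eqP => [/forallP/(_ t)|st]; first by rewrite leqnn => /eqP.
  by apply/forallP => t'; apply/implyP => /(no321_fixed_above xt st)/eqP.
rewrite fixE -val_eqE /=.
have -> : n <= (s^-1)%g t = false by rewrite leqNgt ltn_ord.
have le1 := no321_perm_inv_le xt.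
have [xst|xst] := leqP x (s t); last by lia.
have := no321_perm_inv_le xst; rewrite permK leq_eqVlt => /orP[/eqP->|ltst].
  by rewrite ltnn eqxx andbF.
have : (s^-1)%g t != t.
  by apply: contraTneq ltst => E; rewrite -{2}E permKV ltnn.
by rewrite -val_eqE /=; lia.
Qed.

End LastPoint.

(** * Row insertion of the last letter *)

Lemma lift_perm_ex n (i : 'I_n.+1) (s : 'S_n.+1) :
  exists s' : 'S_n, s = lift_perm i (s i) s'.
Proof.
have ne k : s i != s (lift i k) by rewrite (inj_eq perm_inj) neq_lift.
pose f k := sval (unlift_some (ne k)).
have fE k : lift (s i) (f k) = s (lift i k) by case: (svalP (unlift_some (ne k))).
have f_inj : injective f.
  by move=> k k' /(congr1 (lift (s i))); rewrite !fE => /perm_inj/lift_inj.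
exists (perm f_inj); apply/permP => k.
have [k' ->|->] := unliftP i k; last by rewrite lift_perm_id.
by rewrite lift_perm_lift permE fE.
Qed.

Lemma one_line_lift_perm n (x : 'I_n.+1) (s : 'S_n) :
  one_line (lift_perm ord_max x s) = rcons (map (bump x) (one_line s)) x.
Proof.
rewrite /one_line enum_ordSr map_rcons lift_perm_id -!map_comp; congr rcons.
apply: eq_map => i /=; rewrite (_ : widen_ord _ i = lift ord_max i) ?lift_perm_lift //.
by apply: val_inj; rewrite /= /bump leqNgt ltn_ord.
Qed.

Lemma size_one_line n (s : 'S_n) : size (one_line s) = n.
Proof. by rewrite size_map size_enum_ord. Qed.

Lemma rs_rcons w x : rs (rcons w x) = rs_step (rs w) (size w, x).
Proof.
rewrite /rs size_rcons -addn1 iotaD -cats1 zip_cat ?size_iota // foldl_cat /=.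
by rewrite add0n.
Qed.

Section Relabel.

Variable f : nat -> nat.
Hypothesis f_mono : {mono f : a b / a < b}.

Lemma find_relabel x row :
  find (fun y => f x < y) (map f row) = find (fun y => x < y) row.
Proof. by rewrite find_map; apply: eq_find => y /=; rewrite f_mono. Qed.

Lemma rs_insert_relabel P x :
  rs_insert (map (map f) P) (f x) = map (map f) (rs_insert P x).
Proof.
elim: P x => //= row P IH x; rewrite find_relabel size_map; case: ifP => ltk /=.
  rewrite (nth_map 0) // IH; congr (_ :: _).
  by rewrite !set_nthE size_map ltk map_cat /= map_take map_drop.
by rewrite map_rcons.
Qed.

Lemma rs_new_row_relabel P x : rs_new_row (map (map f) P) (f x) = rs_new_row P x.
Proof.
elim: P x => //= row P IH x; rewrite find_relabel size_map; case: ifP => ltk //.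
by rewrite (nth_map 0) // IH.
Qed.

(** Row insertion only compares letters. With [f = bump x] this relates the word without its last
    letter to its standardization. *)
Lemma rs_relabel w : rs (map f w) = (map (map f) (rs w).1, (rs w).2).
Proof.
elim/last_ind: w => // w x IH; rewrite map_rcons !rs_rcons IH size_map.
by rewrite /rs_step /= rs_insert_relabel rs_new_row_relabel.
Qed.

End Relabel.

Lemma bump_mono x : {mono bump x : a b / a < b}.
Proof. by move=> a b; rewrite /bump; lia. Qed.

Lemma nth0_rs_insert P x (R := nth [::] P 0) (k := find (fun y => x < y) R) :
  nth [::] (rs_insert P x) 0 = if k < size R then set_nth 0 R k x else rcons R x.
Proof. by rewrite {}/k {}/R; case: P => //= R P; case: ifP. Qed.

Lemma nth1_rs_insert P x (R := nth [::] P 0) (k := find (fun y => x < y) R) :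
  nth [::] (rs_insert P x) 1 =
    if k < size R then nth [::] (rs_insert (behead P) (nth 0 R k)) 0
    else nth [::] P 1.
Proof. by rewrite {}/k {}/R; case: P => //= R P; case: ifP. Qed.

Lemma rs_new_rowE P x (R := nth [::] P 0) (k := find (fun y => x < y) R) :
  rs_new_row P x =
    if k < size R then (rs_new_row (behead P) (nth 0 R k)).+1 else 0.
Proof. by rewrite {}/k {}/R; case: P. Qed.

Lemma nth1_add_cell Q r t : nth [::] (add_cell Q r t) 1 =
  if r == 1 then rcons (nth [::] Q 1) t else nth [::] Q 1.
Proof. by rewrite /add_cell nth_set_nth /= eq_sym; case: eqP => [<-|]. Qed.

Definition rows n (s : 'S_n) :=
  let PQ := rs (one_line s) in
  (nth [::] PQ.1 0, nth [::] PQ.1 1, nth [::] PQ.2 1).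

Variant insert_spec n x (R0 R1 Q1 : seq nat) : seq nat * seq nat * seq nat -> Prop :=
| InsertAppend of (forall y, y \in R0 -> y < x) :
    insert_spec n x R0 R1 Q1 (rcons (map (bump x) R0) x, map (bump x) R1, Q1)
| InsertBump L y M of R0 = L ++ y :: M & (forall z, z \in L -> z < x) & x <= y
    & (forall z, z \in M -> y < z) :
    insert_spec n x R0 R1 Q1
      (map (bump x) L ++ x :: map (bump x) M, rcons (map (bump x) R1) y.+1,
       rcons Q1 n).

(** By the last hypothesis no entry of the second row exceeds the bumped letter, so that letter is
    appended there and the bumping stops. *)
Lemma rows_lift_perm n (x : 'I_n.+1) (s : 'S_n) R0 R1 Q1 :
    rows s = (R0, R1, Q1) -> sorted ltn R0 ->
    (forall y z, y \in R0 -> x <= y -> z \in R1 -> z <= y) ->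
  insert_spec n x R0 R1 Q1 (rows (lift_perm ord_max x s)).
Proof.
rewrite /rows one_line_lift_perm rs_rcons (rs_relabel (@bump_mono x)).
rewrite size_map size_one_line; move: (rs _) => [P Q] /= [E0 E1 EQ] srt top.
rewrite nth1_add_cell nth1_rs_insert nth0_rs_insert rs_new_rowE EQ.
have Eb i : nth [::] (map (map (bump x)) P) i = map (bump x) (nth [::] P i).
  have [h|h] := ltnP i (size P); first exact: nth_map.
  by rewrite !nth_default ?size_map.
rewrite !Eb E0 E1 size_map.
set k := find _ _; have kE : k = find (fun y => x <= y) R0.
  by rewrite /k find_map; apply: eq_find => y /=; rewrite /bump; lia.
case: ifP => ltk; last first.
  apply: InsertAppend => y yR; rewrite ltnNge; apply/negP => xy.
  by move: ltk; rewrite kE -has_find => /negP[]; apply/hasP; exists y.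
pose y := nth 0 R0 k.
have xy : x <= y by rewrite /y kE; apply: nth_find; rewrite has_find -kE.
have RE : R0 = take k R0 ++ y :: drop k.+1 R0.
  by rewrite -drop_nth // cat_take_drop.
have yR : y \in R0 by rewrite mem_nth.
have fy : bump x y = y.+1 by rewrite /bump xy.
rewrite (nth_map 0) // -/y fy.
have E1' : nth [::] (behead [seq [seq bump x i | i <- i] | i <- P]) 0
         = map (bump x) R1.
  by rewrite nth_behead Eb E1.
have nok : (find (fun z => y.+1 < z) (map (bump x) R1) < size (map (bump x) R1)) = false.
  rewrite -has_find; apply/hasP => -[_ /mapP[z zR ->]].
  by have := top y z yR xy zR; rewrite /bump; lia.
rewrite nth0_rs_insert rs_new_rowE E1' nok eqxx.
rewrite set_nthE size_map ltk -map_take -map_drop.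
apply: InsertBump => // z.
  move=> /(nthP 0)[i]; rewrite size_takel ?(ltnW ltk) // => ltik <-.
  by rewrite nth_take // ltnNge (before_find 0) // -kE.
move: srt; rewrite {1}RE sorted_pairwise; last exact: ltn_trans.
by rewrite pairwise_cat /= => /and4P[_ _ /allP yM _] zM; apply: yM.
Qed.

(** * The path of the tableaux *)

(* A letter inserted at or below [y] completes the descent of [rows_descent]  *)
(* to a 321 pattern; this is why no entry ever reaches a third row.           *)
Record rows_spec n (s : 'S_n) (R0 R1 Q1 : seq nat) : Prop := RowsSpec {
  row0_sorted : sorted ltn R0;
  row0_lt : forall y, y \in R0 -> y < n;
  row1_lt : forall z, z \in R1 -> z < n;
  rowQ_lt : forall t, t \in Q1 -> t < n;
  rows_cover : forall t, t < n -> t \notin R0 -> t \in R1;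
  rows_descent : forall y z, y \in R0 -> z \in R1 -> y < z ->
    exists i j : 'I_n, [/\ i < j, s i = z :> nat, y <= s j & s j < s i] }.

Lemma perm_val_ex n (s : 'S_n) z : z < n -> exists i : 'I_n, s i = z :> nat.
Proof. by move=> ltz; exists ((s^-1)%g (Ordinal ltz)); rewrite permKV. Qed.

Section InsertLast.

Variables (n : nat) (x : 'I_n.+1) (s : 'S_n) (R0 R1 Q1 : seq nat).
Hypothesis av : no321 (lift_perm ord_max x s).
Hypothesis sR : rows_spec s R0 R1 Q1.

Lemma rows_no_descent y z : y \in R0 -> x <= y -> z \in R1 -> z <= y.
Proof.
move=> yR xy zR; rewrite leqNgt; apply/negP => yz.
have [i [j [ij _ yj ji]]] := rows_descent sR yR zR yz.
exact: (no321_no_descent av ij (leq_trans xy yj) ji).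
Qed.

(** A missing [z] would lie in the second row above [y], against [rows_no_descent]. *)
Lemma row0_up_closed y z : y \in R0 -> x <= y -> y <= z < n -> z \in R0.
Proof.
move=> yR xy /andP[]; rewrite leq_eqVlt => /orP[/eqP<-//|yz] zn.
apply: contraTT yz => /(rows_cover sR zn) /(rows_no_descent yR xy).
by rewrite leqNgt.
Qed.

Lemma rows_spec_insert R0' R1' Q1' :
    insert_spec n x R0 R1 Q1 (R0', R1', Q1') ->
  rows_spec (lift_perm ord_max x s) R0' R1' Q1'.
Proof.
have lexn : x <= n by rewrite -ltnS.
have b_lt i : i < n -> bump x i < n.+1 by rewrite /bump; lia.
have cases t : t < n.+1 -> t = x \/ exists2 t', t' < n & t = bump x t'.
  move=> ltt; have [ltx|gtx|->] := ltngtP t x; [right|right|by left].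
    by exists t; rewrite ?/bump; lia.
  by exists t.-1; rewrite ?/bump; lia.
(* Old descents survive the relabelling ([desc]); the new ones end at the last letter ([last]). *)
have desc y z : y \in R0 -> z \in R1 -> bump x y < bump x z ->
    exists i j : 'I_n.+1, [/\ i < j, lift_perm ord_max x s i = bump x z :> nat,
      bump x y <= lift_perm ord_max x s j
      & lift_perm ord_max x s j < lift_perm ord_max x s i].
  move=> yR zR; rewrite bump_mono => yz.
  have [i [j [ij <- yj ji]]] := rows_descent sR yR zR yz.
  exists (lift ord_max i), (lift ord_max j); rewrite !lift_perm_lift !lift_max.
  by split=> //=; rewrite /bump; lia.
have last y z : z < n -> y <= x -> x < bump x z ->
    exists i j : 'I_n.+1, [/\ i < j, lift_perm ord_max x s i = bump x z :> nat,
      y <= lift_perm ord_max x s j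
      & lift_perm ord_max x s j < lift_perm ord_max x s i].
  move=> zn yx xz; have [i iz] := perm_val_ex s zn.
  exists (lift ord_max i), ord_max.
  by rewrite lift_perm_lift lift_perm_id lift_max /= iz; split.
have srtP := sorted_pairwise ltn_trans; have := row0_sorted sR; rewrite srtP => srt.
case E: _ / => [lex|L y M RE Lx xy yM]; case: E => -> -> ->.
  split.
  - rewrite srtP -cats1 pairwise_cat /= allrel1r andbT; apply/andP; split.
      by apply/allP => _ /mapP[y /lex yx ->]; rewrite /bump; lia.
    by rewrite pairwise_map; apply: sub_pairwise srt => a b /=; rewrite bump_mono.
  - move=> y; rewrite mem_rcons inE => /orP[/eqP->|/mapP[z /(row0_lt sR)/b_lt h ->]] //.
  - by move=> _ /mapP[z /(row1_lt sR)/b_lt h ->].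
  - by move=> t /(rowQ_lt sR)/leqW.
  - move=> t /cases[->|[t' lt' ->]]; first by rewrite mem_rcons mem_head.
    rewrite mem_rcons inE negb_or => /andP[_ nt]; apply: map_f.
    by apply: (rows_cover sR lt'); apply: contra nt => /(map_f (bump x)).
  - move=> y z; rewrite mem_rcons inE => /orP[/eqP->|/mapP[y' y'R ->]] /mapP[z' z'R ->].
      by apply: last; [exact: row1_lt sR _ z'R|].
    exact: desc.
have yR : y \in R0 by rewrite RE mem_cat mem_head orbT.
have yn := row0_lt sR yR.
have fy : bump x y = y.+1 by rewrite /bump xy.
have subL : {subset L <= R0} by move=> z zL; rewrite RE mem_cat zL.
have subM : {subset M <= R0} by move=> z zM; rewrite RE mem_cat inE zM !orbT.
split.
- move: srt; rewrite srtP RE !pairwise_cat /= !pairwise_map.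
  case/and4P=> _ pL _ pM; apply/and4P; split.
  + apply/allrelP => _ b /mapP[a aL ->]; have := Lx _ aL.
    rewrite inE => ax /orP[/eqP->|/mapP[c /yM yc ->]]; rewrite /bump; lia.
  + by apply: sub_pairwise pL => a b /=; rewrite bump_mono.
  + by apply/allP => _ /mapP[c /yM yc ->]; rewrite /bump; lia.
  + by apply: sub_pairwise pM => a b /=; rewrite bump_mono.
- move=> z; rewrite mem_cat inE => /or3P[/mapP[c /subL cR ->]|/eqP->|/mapP[c /subM cR ->]] //;
  exact/b_lt/(row0_lt sR).
- move=> z; rewrite mem_rcons inE => /orP[/eqP->|/mapP[c /(row1_lt sR)/b_lt h ->]] //.
- move=> t; rewrite mem_rcons inE => /orP[/eqP->|/(rowQ_lt sR)/leqW] //.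
- move=> t /cases[->|[t' lt' ->]]; first by rewrite mem_cat mem_head orbT.
  rewrite mem_cat !inE !negb_or => /and3P[nL nx nM].
  rewrite mem_rcons inE -fy; have [->|nty] := eqVneq t' y; first by rewrite eqxx.
  apply/orP; right; apply: map_f; apply: (rows_cover sR lt').
  rewrite RE mem_cat inE !negb_or nty /=; apply/andP; split.
    by apply: contra nL => /(map_f (bump x)).
  by apply: contra nM => /(map_f (bump x)).
move=> y' z'; rewrite mem_rcons inE mem_cat inE => hy' /orP[/eqP->|/mapP[z zR ->]].
  move=> lty'; rewrite -fy; apply: last; rewrite ?fy //.
  case/or3P: hy' lty' => [/mapP[c /Lx cx ->]|/eqP->//|/mapP[c /yM yc ->]]; rewrite /bump; lia.
case/or3P: hy' => [/mapP[c /subL cR ->]|/eqP->|/mapP[c /subM cR ->]]; first exact: desc.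
  by apply: last; [exact: row1_lt sR _ zR|].
exact: desc.
Qed.

End InsertLast.

Lemma nth_Psi n (s : 'S_n) R0 R1 Q1 b i : rows s = (R0, R1, Q1) -> i < n + n ->
  nth b (Psi s) i = if i < n then i \in R0 else (n + n).-1 - i \in Q1.
Proof.
case=> E0 _ EQ lti; rewrite /Psi /path_of_tableaux E0 EQ nth_cat size_map size_iota.
case: ifP => ltin; first by rewrite (nth_map 0) ?size_iota // nth_iota.
rewrite (nth_map 0) ?size_rev ?size_iota; last by lia.
rewrite nth_rev size_iota; last by lia.
rewrite nth_iota; last by lia.
by rewrite (_ : 0 + _ = (n + n).-1 - i) //; lia.
Qed.

Lemma size_Psi n (s : 'S_n) : size (Psi s) = n + n.
Proof. by rewrite size_cat !size_map size_rev !size_iota. Qed.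

Lemma mem_map_bump h (S : seq nat) t :
  (t \in map (bump h) S) = (t != h) && (unbump h t \in S).
Proof.
apply/mapP/andP => [[u uS ->]|[nth uS]]; last by exists (unbump h t); rewrite ?unbumpK.
by rewrite bumpK eq_sym neq_bump.
Qed.

(** If [x] is appended, the old path reads [d^(n-x)] from [x] to the center and the new one reads
    [u d^(n-x) d]. If [x] bumps [y], the old stretch is [d^(y-x) u^(n-y)]; the new first half ends
    in [u d^(y-x) d u^(n-y-1)], and the new cell of [Q] supplies one more [u]. Either way the result
    is [u d] followed by the old stretch. *)
Lemma Psi_insert n (x : 'I_n.+1) (s : 'S_n) R0 R1 Q1 :
    no321 (lift_perm ord_max x s) ->
    rows s = (R0, R1, Q1) -> rows_spec s R0 R1 Q1 ->
  [/\ Psi (lift_perm ord_max x s) = ins_peak x (Psi s)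
    & downs_first x n (Psi s)].
Proof.
move=> av Es sR; have lexn : x <= n by rewrite -ltnS.
have Dx : downs_first x n (Psi s).
  move=> y z xy /andP[yz zn]; rewrite !(nth_Psi _ Es); try lia.
  rewrite zn (ltn_trans yz zn) => yR.
  by apply: (row0_up_closed av sR yR xy); rewrite (ltnW yz).
split=> //; apply: (@eq_from_nth _ false).
  by rewrite size_ins_peak !size_Psi; lia.
rewrite size_Psi => i lti; rewrite nth_ins_peak ?size_Psi; last by lia.
have := rows_lift_perm Es (row0_sorted sR) (rows_no_descent av sR).
case E': (rows _) => [[R0' R1'] Q1']; rewrite (nth_Psi _ E' lti).
case E: _ / => [lex|L y M RE Lx xy yM]; case: E => -> _ ->.
  have outR t : x <= t -> (t \in R0) = false.
    by move=> xt; apply/negbTE; apply: contraTN xt => /lex; rewrite -ltnNge.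
  rewrite mem_rcons inE mem_map_bump.
  case: ifP => ltin; last first.
    have -> : i < x = false by lia.
    have -> : (i == x :> nat) = false by lia.
    case: ifP => ix.
      by apply/negbTE/negP => /(rowQ_lt sR); lia.
    rewrite (nth_Psi _ Es); last by lia.
    case: ifP => i2; last by f_equal; lia.
    rewrite outR; last by lia.
    by apply/negbTE/negP => /(rowQ_lt sR); lia.
  have [ltix|gtix|->] := ltngtP i x.
  - rewrite (nth_Psi _ Es); last by lia.
    by rewrite /unbump ltnNge (ltnW ltix) subn0 (leq_trans ltix).
  - rewrite /unbump gtix subn1 outR; last by lia.
    case: ifP => // ix; rewrite (nth_Psi _ Es); last by lia.
    by case: ifP => i2; [rewrite outR | ]; lia.
  - by [].
have yR : y \in R0 by rewrite RE mem_cat mem_head orbT.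
have yn := row0_lt sR yR.
have inR t : x <= t -> t < n -> (t \in R0) = (y <= t).
  move=> xt tn; apply/idP/idP => [|yt]; last by apply: (row0_up_closed av sR yR xy); rewrite yt.
  by rewrite RE mem_cat inE => /or3P[/Lx|/eqP->|/yM]; lia.
have inM t : x <= t -> t < n -> (t \in M) = (y < t).
  move=> xt tn; apply/idP/idP => [/yM//|yt].
  have := inR t xt tn; rewrite (ltnW yt) RE mem_cat inE.
  by case/or3P=> // [/Lx|/eqP]; lia.
have inL t : t < x -> (t \in L) = (t \in R0).
  move=> tx; rewrite RE mem_cat inE; case: (t \in L) => //=; symmetry.
  by apply/negbTE; apply/negP => /orP[/eqP|/yM]; lia.
have outL t : x <= t -> (t \in L) = false.
  by move=> xt; apply/negbTE; apply: contraTN xt => /Lx; rewrite -ltnNge.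
have outM t : t < x -> (t \in M) = false.
  by move=> tx; apply/negbTE/negP => /yM; lia.
rewrite mem_cat inE !mem_map_bump mem_rcons inE.
case: ifP => ltin; last first.
  have -> : i < x = false by lia.
  have -> : (i == x :> nat) = false by lia.
  have -> : (i == x.+1) = false by lia.
  rewrite (nth_Psi _ Es); last by lia.
  case: ifP => i2.
    (* Here [i = n.+1]: the first step of the new second half faces the last step of the old first
       half. *)
    rewrite inR; [|lia..].
    have -> : (n.+1 + n.+1).-1 - i = n by lia.
    by rewrite eqxx; lia.
  have -> : ((n.+1 + n.+1).-1 - i == n) = false by lia.
  by rewrite /=; f_equal; lia.
have [ltix|gtix|->] := ltngtP i x; last by rewrite orbT.
- rewrite (nth_Psi _ Es); last by lia.
  rewrite /unbump (ltnNge x) (ltnW ltix) subn0 outM // orbF inL //.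
  by rewrite (leq_trans ltix).
rewrite /unbump gtix subn1 outL ?inM /=; [|lia..].
case: ifP => [|ix]; first by lia.
rewrite (nth_Psi _ Es); last by lia.
have i2 : i - 2 < n by lia.
by rewrite i2 inR; lia.
Qed.

(** * Central pyramids, final fixed points, and the induction *)

Lemma nups_lip D i j : nups D (i + j) <= nups D i + j.
Proof. by elim: j => [|j IH]; rewrite ?addn0 // !addnS nupsS; case: nth; lia. Qed.

(** If [x = n], the peak is inserted at the center, and both the pyramid and the run of final fixed
    points grow by one. If [x < n], the last point is not fixed, and the new center is not a peak:
    the step before it is the inserted [d], or both steps around it come from a stretch
    [d^k u^m]. *)
Lemma pyramid_insert n (x : 'I_n.+1) (s : 'S_n) D :
    size D = n + n -> downs_first x n D ->
    (forall l, l <= n -> pyramid n D l = fixes_from s (n - l)) ->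
  forall l, l <= n.+1 ->
    pyramid n.+1 (ins_peak x D) l = fixes_from (lift_perm ord_max x s) (n.+1 - l).
Proof.
move=> szD Dx IH [|l] ltl.
  rewrite /pyramid !subn0 !addn0 !eqxx; symmetry; apply/forallP => t.
  by rewrite leqNgt ltn_ord.
have lexn : x <= n by rewrite -ltnS.
have lexD : x <= size D by lia.
rewrite subSS /pyramid subSS; have [xn|nxn] := eqVneq (x : nat) n.
  rewrite !nups_ins_peak // xn ltnn leq_subr.
  have -> : maxn n (n.+1 - 2) = n by lia.
  have -> : n.+1 + l.+1 <= n = false by lia.
  have -> : maxn n (n.+1 + l.+1 - 2) = n + l by lia.
  rewrite addnS !eqSS -/(pyramid n D l) IH //.
  have bumpE (k : 'I_n) : bump n k = k by rewrite /bump leqNgt ltn_ord.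
  apply/forallP/forallP => fixs t; apply/implyP.
    have [t' ->|->] := unliftP ord_max t; last by rewrite lift_perm_id -val_eqE /= xn.
    rewrite lift_max lift_perm_lift -val_eqE /= xn !bumpE.
    by have := implyP (fixs t').
  have := implyP (fixs (lift ord_max t)).
  by rewrite lift_max lift_perm_lift -val_eqE /= xn !bumpE.
have -> : fixes_from (lift_perm ord_max x s) (n - l) = false.
  apply/negbTE/negP => /forallP/(_ ord_max).
  by rewrite lift_perm_id /= leq_subr -val_eqE /= (negPf nxn).
apply/negbTE/negP => /andP[/eqP up /eqP down].
have h1 := nups_lip (ins_peak x D) (n - l) l; rewrite subnK // in h1.
have h2 := @nups_mono (ins_peak x D) n.+2 (n.+1 + l.+1) ltac:(lia).
rewrite (nupsS _ n.+1) in h2; rewrite nupsS in up.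
have {up} : nth false (ins_peak x D) n by lia.
have {h2} : ~~ nth false (ins_peak x D) n.+1 by lia.
rewrite !nth_ins_peak //.
have -> : n.+1 < x = false by lia.
have -> : n < x = false by lia.
have -> : (n.+1 == x) = false by lia.
have -> : (n.+1 == x.+1) = false by lia.
rewrite (eq_sym n) (negPf nxn); case: ifP => // nx1 /negP nD Dn; apply: nD.
by apply: (Dx (n - 2)) => //; lia.
Qed.

(** The rows are carried along so that [Psi_insert] applies at the next step, and the pyramid
    equality so that the two changes agree. *)
Lemma crs_matches n (s : 'S_n) : no321 s -> exists R0 R1 Q1 (p : 'S_n),
  [/\ rows s = (R0, R1, Q1), rows_spec s R0 R1 Q1, nups (Psi s) (n + n) = n,
      matches (Psi s) p /\ crs p = crs s
    & forall l, l <= n -> pyramid n (Psi s) l = fixes_from s (n - l)].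
Proof.
elim: n s => [|n IH] s av.
  (* For [n = 0] there is no label to match, so [s] itself serves as [p]. *)
  exists [::], [::], [::], s; split=> //.
  - by rewrite /rows /one_line (size0nil (size_enum_ord 0)).
  - by split=> // -[].
  by case=> // _; rewrite /pyramid !eqxx; symmetry; apply/forallP => -[].
have [s' sE] := lift_perm_ex ord_max s; move: (s ord_max) sE => x sE.
rewrite {}sE in av *.
have [R0 [R1 [Q1 [p [Es sR cuD [mp crsE'] pyr]]]]] := IH _ (no321_lift av).
have [PsiE Dx] := Psi_insert av Es sR.
have lexn : x <= n by rewrite -ltnS.
have szD := size_Psi s'; have lexD : x <= size (Psi s') by lia.
have xcu := nups_add_ndowns lexD.
have lecu := @nups_mono (Psi s') x (n + n) ltac:(lia).
have ltU : n - nups (Psi s') x < n.+1 by lia.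
have ltV : ndowns (Psi s') x < n.+1 by lia.
have := rows_lift_perm Es (row0_sorted sR) (rows_no_descent av sR).
case E: (rows _) => [[R0' R1'] Q1'] ins.
exists R0', R1', Q1', (lift_perm (Ordinal ltU) (Ordinal ltV) p); split=> //.
- exact: rows_spec_insert ins.
- rewrite PsiE nups_ins_peak //.
  have -> : n.+1 + n.+1 <= x = false by lia.
  have -> : maxn x (n.+1 + n.+1 - 2) = n + n by lia.
  by rewrite cuD.
- rewrite PsiE; split; first by apply: matches_ins_peak => //=; lia.
  have := crs_insert_last av.
  have := crs_insert_label szD lexn Dx mp (U := Ordinal ltU) (V := Ordinal ltV).
  rewrite (eq_big_nat _ _ (F2 := fun l => nat_of_bool (fixes_from s' (n - l)))).
    by move=> /= /(_ ltac:(lia) erefl); lia.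
  by move=> l hl; rewrite pyr //; lia.
by rewrite PsiE; apply: pyramid_insert.
Qed.

Theorem theorem3p2 (n : nat) (hn : 0 < n) (sigma : 'S_n) :
  sigma \in avoiding n patt321 -> crs (Theta sigma) = crs sigma.
Proof.
move=> /avoiding_no321/crs_matches[_ [_ [_ [p [_ _ cuD [mp <-] _]]]]].
by rewrite /Theta (matches_Phi_inv _ mp) ?size_Psi.
Qed.
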